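(* Every continuum of weight $\aleph_1$ is a continuous image of $\mathbb{H}^*$; that is, for every continuum $K$ of weight $\aleph_1$ there is a continuous surjection from $\mathbb{H}^*$ onto $K$.
   Context: A continuum is a (nonempty) compact connected Hausdorff space. The weight of a space is the least cardinality of a base for its topology. $\mathbb{H}=[0,\infty)$ is the half line with its usual topology, and $\mathbb{H}^*=\beta\mathbb{H}\setminus\mathbb{H}$ is its Čech–Stone remainder. *)

(* Defs.v *)
From HB Require Import structures.
From mathcomp Require Import all_boot all_order all_algebra.
From mathcomp Require Import all_classical all_reals all_analysis.

Set Implicit Arguments.
Unset Strict Implicit.
Unset Printing Implicit Defensive.
Import Order.TTheory GRing.Theory Num.Theory numFieldNormedType.Exports.
Local Open Scope classical_set_scope.
Local Open Scope ring_scope.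
Local Open Scope card_scope.

Definition continuum (K : topologicalType) : Prop :=
  [/\ [set: K] !=set0, compact [set: K], connected [set: K] &
      hausdorff_space K].

(* [A] has the least uncountable cardinality. *)
Definition card_aleph1 (T : Type) (A : set T) : Prop :=
  ~ countable A /\ forall (U : Type) (B : set U), ~ countable B -> A #<= B.

Definition weight_aleph1 (X : topologicalType) : Prop :=
  exists B : set (set X),
    [/\ basis B, forall C : set (set X), basis C -> B #<= C & card_aleph1 B].

(* Wherever a set is used as a space below, it is coerced to the subtype of its elements,
   which carries the subspace topology ([set_type], not [subspace]). *)
Definition half_line (R : realType) : topologicalType := `[0 : R, +oo[%classic.

Definition unit_interval (R : realType) : topologicalType :=
  `[0 : R, 1]%classic.

(* The cube [0,1]^C(X,[0,1]) with the product topology. *)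
Definition cech_cube (R : realType) (X : topologicalType) : topologicalType :=
  prod_topology (fun _ : continuousType X (unit_interval R) => unit_interval R).

Definition cech_eval (R : realType) (X : topologicalType) (x : X) :
  cech_cube R X := fun f => f x.

(* beta X is the closure of the image of X under the evaluation map; this is
   the Cech-Stone compactification for Tychonoff X, where [cech_eval] is an
   embedding, and the remainder is beta X minus the copy of X. *)
Definition cech_stone (R : realType) (X : topologicalType) :
  set (cech_cube R X) := closure (range (@cech_eval R X)).

Definition cech_remainder (R : realType) (X : topologicalType) :
  set (cech_cube R X) := @cech_stone R X `\` range (@cech_eval R X).

Definition half_line_remainder (R : realType) : topologicalType :=
  @cech_remainder R (half_line R).

(* Main.v *)
Require Import Defs.
From mathcomp Require Import all_boot all_order all_algebra.
From mathcomp Require Import all_classical all_reals all_analysis.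
From mathcomp Require wochoice.
From mathcomp Require Import ring lra.
From Stdlib Require Inverse_Image.

Set Implicit Arguments.
Unset Strict Implicit.
Unset Printing Implicit Defensive.
Import Order.TTheory GRing.Theory Num.Theory numFieldNormedType.Exports.
Local Open Scope classical_set_scope.
Local Open Scope card_scope.

(** Fix a point [k0] of [K]. A base of size aleph_1 provides an embedding of
    [K] into a cube by continuous maps [phi i : K -> [0,1]] with
    [phi i k0 = 0], where the index [i] runs over the pairs of members of the
    base ([separating_family]); the set of indices has a well-order all of
    whose proper initial segments are countable ([omega1_like_minimal],
    [omega1_like_pairs]).

    A map of the remainder of the half line onto [K] comes from continuous
    functions [F i] from the half line to the unit interval such that, for each
    finite set of indices, the curve [t |-> (F i t)] accumulates at infinity
    exactly on the image of [K] under the corresponding [phi i]. Indeed a point [p] of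
    the remainder then determines the point [z] of [K] with
    [phi i z = p (F i)] for all [i] ([remainder_point]), all points of [K] are
    obtained ([point_remainder]), and [p |-> z] is continuous because its
    composites with the [phi i] are coordinate projections
    ([walk_limit_map]). The [F i] are piecewise linear with their nodes at the
    integers, so what is needed is a family of sequences [u i] whose increments
    tend to 0 and which have the right joint accumulation points
    ([shadowing_walk]).

    For finitely many indices connectedness is all it takes: given finitely
    many maps [phi i] and [e > 0], there are closed [e]-chains in [K] that
    start from [k0] and pass through any given finite set of points
    ([loop_through]), and [u] lists the coordinates of such chains, one chain
    after another.

    The problem is to serve uncountably many indices simultaneously. Each
    requirement on the chains is a fact about finitely many indices, taken from
    a countable list of relations, and any finite number of these facts can be
    met ([walk_finitely_good]). An omega_1-saturation argument ([saturation])
    turns this into a sequence of assignments for which each of the facts holds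
    from some rank on. The value at a new index is chosen by recursion along
    the well-order, and it must leave room for the later indices. The induction
    hypothesis therefore concerns all formulas that assert the existence of
    unknowns, playing the part of later indices, for which some finite
    conjunction of required facts holds: each such formula holds from some rank
    on. In these formulas the later indices occur only as bound variables, so
    that countably many formulas matter at each step, and a diagonal choice
    takes care of countably many formulas at once ([realize_step]). *)

(** * Well-orders with countable initial segments *)

(** The values of [e] may lie outside [A], so that [A] may be empty. *)
Definition enumerated (T : Type) (A : set T) : Prop :=
  exists e : nat -> T, forall t, A t -> exists n, e n = t.

Definition strict_wo (T : Type) (lt : T -> T -> Prop) : Prop :=
  [/\ well_founded lt, (forall x y z, lt x y -> lt y z -> lt x z) &
      forall x y, [\/ lt x y, x = y | lt y x]].

(** Well-orders of type at most omega_1. *)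
Definition omega1_like (T : Type) (lt : T -> T -> Prop) : Prop :=
  strict_wo lt /\ forall x, enumerated [set y | lt y x].

Lemma exists_strict_wo (T : Type) : exists lt : T -> T -> Prop, strict_wo lt.
Proof.
have [R Rwo] := wochoice.well_ordering_principle {classic T}.
have Rmin (A : set T) : A !=set0 -> exists2 z, A z & forall x, A x -> R z x.
  move=> [x Ax]; have [|z [[Az zmin] _]] := Rwo [pred x | `[< A x >]].
    by exists x; apply/asboolP.
  exists z; first exact/asboolP.
  by move=> y Ay; apply: zmin; apply/asboolP.
have Rtot x y : R x y \/ R y x.
  have [|z [->|->] zmin] := Rmin [set x; y]; first by exists x; left.
    by left; apply: zmin; right.
  by right; apply: zmin; left.
have Ranti x y : R x y -> R y x -> x = y.
  move=> xy yx; have Rrefl z : R z z by have [] := Rtot z z.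
  have [|z [_ zuniq]] := Rwo [pred z | (z == x) || (z == y)].
    by exists x; rewrite inE eqxx.
  rewrite -(zuniq x) ?(zuniq y) //; split; rewrite ?inE ?eqxx ?orbT //.
    by move=> t; rewrite inE => /orP[] /eqP ->.
  by move=> t; rewrite inE => /orP[] /eqP ->.
exists (fun x y => ~ R y x); split.
- move=> x; apply: contrapT => nAx.
  have [|z nAz zmin] := Rmin [set x | ~ Acc (fun x y => ~ R y x) x].
    by exists x.
  by apply: nAz; constructor => y nzy; apply: contrapT => /zmin.
- move=> x y z nyx nzy zx.
  have xy : R x y by have [] := Rtot x y.
  have yz : R y z by have [] := Rtot y z.
  have [|t [[->|->]|->] tmin] := Rmin [set x; y; z]; first by exists x; do 2 left.
  + have xz : R x z by apply: tmin; right.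
    by apply: nzy; rewrite -(Ranti _ _ xz zx).
  + by apply: nyx; apply: tmin; left; left.
  + by apply: nzy; apply: tmin; left; right.
- move=> x y; have [xy|nxy] := pselect (R x y); last by constructor 3.
  have [yx|nyx] := pselect (R y x); last by constructor 1.
  by constructor 2; exact: Ranti.
Qed.

Lemma countable_enumerated (T : Type) (A : set T) (t0 : T) :
  countable A -> enumerated A.
Proof.
move=> /countable_injP [f finj].
exists (fun n => @xget {classic T} t0 [set t | A t /\ f t = n]) => t At; exists (f t).
case: xgetP => [s _ [As fs]|/(_ t) []//].
by apply: finj; rewrite ?inE.
Qed.

Lemma enumerated_inj (T U : Type) (f : T -> U) (A : set U) (t0 : T) :
  injective f -> enumerated A -> enumerated (f @^-1` A).
Proof.
move=> finj [e Ae].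
exists (fun n => @xget {classic T} t0 [set t | f t = e n]) => t /Ae [n en].
exists n; case: xgetP => [s _ fs|/(_ t) /= []//]; apply: finj.
by rewrite -en.
Qed.

Lemma card_leT_inj (T U : Type) (B : set U) :
  [set: T] #<= B -> exists2 f : T -> U, injective f & forall t, B (f t).
Proof.
move=> /card_leP [f].
exists (fun t => \val (f (exist _ t (mem_set (I : setT t))))).
  move=> s t /val_inj fst.
  by have [] := 'inj_f (mem_set (I : setT _)) (mem_set (I : setT _)) fst.
by move=> t; exact: set_valP.
Qed.

(** If some initial segment of a well-order of [T] is uncountable, then [T]
    embeds into the least such segment, all of whose own initial segments are
    countable. *)
Lemma omega1_like_minimal (T : Type) :
  (forall (U : Type) (B : set U), ~ countable B -> [set: T] #<= B) ->
  exists lt : T -> T -> Prop, omega1_like lt.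
Proof.
move=> Tmin; have [lt ltwo] := exists_strict_wo T.
have [wf tr tot] := ltwo.
have [allc|] := pselect (forall x, countable [set y | lt y x]).
  exists lt; split=> // x; exact: countable_enumerated x (allc x).
move=> /existsNP [x].
elim: (wf x) => {}x _ IH nx.
have [|small] := pselect (exists y, lt y x /\ ~ countable [set z | lt z y]).
  by move=> [y [yx ny]]; exact: IH ny.
have [f finj fx] := card_leT_inj (Tmin _ _ nx).
exists (fun s t => lt (f s) (f t)); split; first split.
- exact: (Inverse_Image.wf_inverse_image _ _ lt f wf).
- by move=> s t u; exact: tr.
- move=> s t; case: (tot (f s) (f t)) => [st|/finj st|ts].
  + by constructor 1.
  + by constructor 2.
  + by constructor 3.
- move=> t; apply: (enumerated_inj (f := f) (A := [set y | lt y (f t)])) => //.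
  apply: (countable_enumerated (f t)); apply: contrapT => nt.
  by apply: small; exists (f t); split; [exact: fx|].
Qed.

(** The order compares the ranks first and breaks ties by an arbitrary
    well-order of [T]. *)
Lemma omega1_like_rank (W T : Type) (ltW : W -> W -> Prop) (r : T -> W) :
  strict_wo ltW -> (forall w, enumerated [set t | ~ ltW w (r t)]) ->
  exists lt : T -> T -> Prop, omega1_like lt.
Proof.
move=> [wfW trW totW] enumr; have [lt0 [wf0 tr0 tot0]] := exists_strict_wo T.
have irr w : ~ ltW w w.
  by elim: (wfW w) => {}w _ IH ww; exact: (IH w ww ww).
exists (fun s t => ltW (r s) (r t) \/ (r s = r t /\ lt0 s t)); split; first split.
- move=> t; move: {2}(r t) (erefl (r t)) => w; elim: (wfW w) t => {}w _ IHw t.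
  elim: (wf0 t) => {}t _ IHt tw; constructor => s [st|[st ss]].
    by apply: IHw (erefl _); rewrite -tw.
  by apply: IHt => //; rewrite st.
- move=> s t u [st|[st ss]] [tu|[tu tt]].
  + by left; apply: trW tu.
  + by left; rewrite -tu.
  + by left; rewrite st.
  + by right; rewrite st; split=> //; apply: tr0 tt.
- move=> s t; case: (totW (r s) (r t)) => [st|st|ts].
  + by constructor 1; left.
  + case: (tot0 s t) => [ss|//|ts]; first by constructor 1; right.
      by constructor 2.
    by constructor 3; right.
  + by constructor 3; left.
- move=> t; have [e et] := enumr (r t); exists e => s /= st; apply: et => /= ts.
  case: st => [st|[st _]]; first by exact: irr (trW _ _ _ st ts).
  by move: ts; rewrite st; exact: irr.
Qed.

(** Pairs are ranked by their maximum, so that the pairs up to a given rank form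
    the square of a countable set. *)
Lemma omega1_like_pairs (W : Type) (lt : W -> W -> Prop) :
  omega1_like lt -> exists lt' : W * W -> W * W -> Prop, omega1_like lt'.
Proof.
move=> [ltwo enum]; have [wf tr tot] := ltwo.
pose r (p : W * W) := if pselect (lt p.1 p.2) then p.2 else p.1.
apply: (omega1_like_rank (r := r) ltwo) => w; have [e ew] := enum w.
pose e' n := if n is m.+1 then e m else w.
have e'w v : ~ lt w v -> exists n, e' n = v.
  move=> nwv; case: (tot v w) => [/ew [n <-]|->|//]; first by exists n.+1.
  by exists 0%N.
exists (fun n => if unpickle n is Some (i, j) then (e' i, e' j) else (w, w)).
move=> [a b] /=; rewrite /r /=; case: pselect => /= ab nw.
  have [j <-] := e'w b nw; have [i <-] := e'w a (fun h => nw (tr _ _ _ h ab)).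
  by exists (pickle (i, j)); rewrite pickleK.
have [i <-] := e'w a nw; have [|j <-] := e'w b.
  move=> wb; case: (tot a b) => // [eab|ba]; first by apply: nw; rewrite eab.
  by apply: nw; exact: tr wb ba.
by exists (pickle (i, j)); rewrite pickleK.
Qed.

(** * Saturation *)

Section Saturation.
Variables (I : eqType) (P : Type) (C : countType).
(** [good c l] stands for the requirement that the values at the indices in [l]
    be in the relation [R c]. *)
Variables (R : C -> seq P -> Prop) (good : C -> seq I -> Prop).

(** A finite conjunction of atoms [R b (x_1, ..., x_n)]. A variable [inl i]
    stands for the value at the index [i], and a variable [inr m] is to be
    existentially quantified. *)
Definition formula := seq (C * seq (I + nat)).

Definition value (T : Type) (v : I -> T) (e : nat -> T) (x : I + nat) : T :=
  match x with inl i => v i | inr m => e m end.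

Definition holds (v : I -> P) (e : nat -> P) (c : formula) : Prop :=
  forall q, q \in c -> R q.1 (map (value v e) q.2).

(** The bound variables can be interpreted as indices in such a way that each
    atom becomes one of the required facts. *)
Definition good_formula (c : formula) : Prop :=
  exists rho : nat -> I, forall q, q \in c -> good q.1 (map (value id rho) q.2).

Definition over (A : set I) (c : formula) : Prop :=
  forall q, q \in c -> forall i, inl i \in q.2 -> A i.

(** The induction hypothesis of the construction: [f n] is meaningful on [A]
    only, and the existential quantifier over [e] leaves room for the values at
    the indices outside [A]. *)
Definition realizes (A : set I) (f : nat -> I -> P) : Prop :=
  forall c, over A c -> good_formula c ->
  \forall n \near \oo, exists e, holds (f n) e c.

Definition update (v : I -> P) (i : I) (x : P) : I -> P :=
  fun j => if j == i then x else v j.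

(** Indices outside [A] occur in a good formula over [A] only through bound
    variables. *)
Lemma over_enumerated (A : set I) : enumerated A ->
  enumerated [set c | over A c /\ good_formula c].
Proof.
move=> [e eA].
have /choice [h hK] : forall i, exists n, A i -> e n = i.
  move=> i; have [/eA [n en]|nAi] := pselect (A i).
    by exists n.
  by exists 0%N => /nAi.
pose tr (T : eqType) (g : I -> T) (x : I + nat) : T + nat :=
  match x with inl i => inl (g i) | inr m => inr m end.
pose code (c : formula) : seq (C * seq (nat + nat)) :=
  [seq (q.1, map (tr _ h) q.2) | q <- c].
pose decode (c : seq (C * seq (nat + nat))) : formula :=
  [seq (q.1, map (fun x => match x with inl n => inl (e n) | inr m => inr m end)
    q.2) | q <- c].
exists (fun n => if unpickle n is Some c then decode c else [::]) => c [cA _].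
exists (pickle (code c)); rewrite pickleK /decode -map_comp -[RHS]map_id.
apply/eq_in_map => -[b l] qc /=; congr pair; rewrite -map_comp -[RHS]map_id.
apply/eq_in_map => -[i|m] //= il; congr inl; apply: hK.
exact: cA qc _ il.
Qed.

(** In the formula that is already known to hold, the new index [i] is a bound
    variable; a witness for that variable is a value for [i]. *)
Lemma realize_one (A : set I) (f : nat -> I -> P) (i : I) (c : formula) :
  realizes A f -> over (A `|` [set i]) c -> good_formula c ->
  \forall n \near \oo, exists x e, holds (update (f n) i x) e c.
Proof.
move=> fA cA [rho crho].
pose h (y : I + nat) : I + nat := match y with
  | inl j => if j == i then inr 0%N else inl j
  | inr m => inr m.+1 end.
pose c' : formula := [seq (q.1, map h q.2) | q <- c].
have [||N _ fN] := fA c'.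
- move=> _ /mapP[q qc ->] j /= /mapP[[k|//] kq /=].
  by case: eqP => // ki [->]; case: (cA _ qc _ kq).
- exists (fun n => if n is m.+1 then rho m else i) => _ /mapP[q qc ->] /=.
  rewrite -map_comp (_ : map _ _ = map (value id rho) q.2); first exact: crho.
  by apply: eq_map => -[j|m] //=; case: eqP.
exists N => // n /fN [e eh]; exists (e 0%N), (fun m => e m.+1) => q qc.
have := eh (q.1, map h q.2) (map_f _ qc); rewrite /= -map_comp.
congr (R _ _); apply: eq_map => -[j|m] //=.
by rewrite /update; case: eqP.
Qed.

(** The conjunction of formulas whose bound variables are first renamed apart,
    the variable [m] of the [k]-th formula becoming the code of [(k, m)]. *)
Lemma good_conj (cs : nat -> formula) (K : nat) (A : set I) :
  (forall k, over A (cs k) /\ good_formula (cs k)) ->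
  exists c, [/\ over A c, good_formula c & forall v e, holds v e c ->
    forall k, (k <= K)%N -> exists e', holds v e' (cs k)].
Proof.
move=> cs_good.
have [rho rhoP] := choice (fun k => (cs_good k).2).
pose h (k : nat) (y : I + nat) : I + nat := match y with
  | inl j => inl j | inr m => inr (pickle (k, m : nat)) end.
pose c : formula :=
  flatten [seq [seq (q.1, map (h k) q.2) | q <- cs k] | k <- iota 0 K.+1].
exists c; split.
- move=> _ /flattenP[_ /mapP[k _ ->] /mapP[q qc ->]] j /= /mapP[[k'|//] kq /= [->]].
  exact: (cs_good k).1 qc _ kq.
- exists (fun n => if unpickle n is Some (k, m) then rho k m else rho 0%N 0%N).
  move=> _ /flattenP[_ /mapP[k _ ->] /mapP[q qc ->]] /=.
  rewrite -map_comp (_ : map _ _ = map (value id (rho k)) q.2).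
    exact: rhoP.
  by apply: eq_map => -[j|m] //=; rewrite pickleK.
- move=> v e ec k kK; exists (fun m => e (pickle (k, m : nat))) => q qc.
  have := ec (q.1, map (h k) q.2); rewrite /= -map_comp.
  rewrite (_ : map _ _ = map (value v (fun m => e (pickle (k, m : nat)))) q.2).
    apply; apply/flattenP; exists [seq (q.1, map (h k) q.2) | q <- cs k].
      by apply/mapP; exists k => //; rewrite mem_iota.
    exact: (map_f (fun q => (q.1, map (h k) q.2))).
  by apply: eq_map => -[j|m].
Qed.

(** The good formulas over the enlarged set are listed as [cs 0], [cs 1], ...
    For each [k], if [n] is large then some value at [i] keeps the formulas
    [cs 0], ..., [cs k] satisfiable at once; [g n] is such a value for the
    largest possible [k <= n]. *)
Lemma realize_step (A : set I) (f : nat -> I -> P) (i : I) :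
  enumerated A -> realizes A f ->
  exists g : nat -> P, realizes (A `|` [set i]) (fun n => update (f n) i (g n)).
Proof.
move=> [a aA] fA.
have /over_enumerated [cs0 cs0P] : enumerated (A `|` [set i]).
  exists (fun n => if n is m.+1 then a m else i) => j [/aA [m <-]|->].
    by exists m.+1.
  by exists 0%N.
have nilgood : over (A `|` [set i]) [::] /\ good_formula [::].
  by split=> //; exists (fun=> i).
pose cs k := if pselect (over (A `|` [set i]) (cs0 k) /\ good_formula (cs0 k))
  then cs0 k else [::].
have csgood k : over (A `|` [set i]) (cs k) /\ good_formula (cs k).
  by rewrite /cs; case: pselect.
pose ok n x k := forall m, (m <= k)%N ->
  exists e, holds (update (f n) i x) e (cs m).
have evok k : \forall n \near \oo, exists x, ok n x k.
  have [c [cA cgood cE]] := good_conj k csgood.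
  apply: filterS (realize_one fA cA cgood) => n [x [e eh]].
  by exists x => m mk; exact: cE eh m mk.
have /choice [g gP] : forall n, exists y, forall k, (k <= n)%N ->
    (exists x, ok n x k) -> ok n y k.
  move=> n; suff: forall b, exists y, forall k, (k <= b)%N ->
    (exists x, ok n x k) -> ok n y k by apply.
  move=> b.
  have x0 : P by exact: (f 0%N i).
  elim: b => [|b [x IH]].
    have [[x xok]|nok] := pselect (exists x, ok n x 0%N).
      by exists x => k; rewrite leqn0 => /eqP ->.
    by exists x0 => k; rewrite leqn0 => /eqP ->.
  have [[y yok]|nok] := pselect (exists x, ok n x b.+1).
    by exists y => k kb _ m mk; apply: yok; exact: leq_trans kb.
  exists x => k; rewrite leq_eqVlt => /orP[/eqP -> //|]; exact: IH.
exists g => c cA cgood.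
have [k csk] := cs0P c (conj cA cgood).
have csE : cs k = c by rewrite /cs csk; case: pselect => // -[].
rewrite -csE; apply: filterS2 (evok k) (nbhs_infty_ge k) => n nok kn.
exact: (gP n k kn nok).
Qed.

Lemma realizes_ext (A : set I) (f g : nat -> I -> P) :
  (forall n i, A i -> f n i = g n i) -> realizes A f -> realizes A g.
Proof.
move=> fg fA c cA /(fA c cA); apply: filterS => n [e eh]; exists e => q qc.
have := eh q qc; congr (R _ _); apply/eq_in_map => -[j|//] /= jq.
by apply: fg; exact: cA jq.
Qed.

(** The last clause says that [i] occurs in [c]. *)
Lemma max_index (lt : I -> I -> Prop) (c : formula) : strict_wo lt ->
  over set0 c \/ exists i, [/\ over [set j | j = i \/ lt j i] c &
    ~ over [set j | j <> i] c].
Proof.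
move=> [_ tr tot].
pose l := pmap (fun x : I + nat => if x is inl i then Some i else None)
  (flatten [seq q.2 | q <- c]).
have lP i : i \in l <-> exists2 q, q \in c & inl i \in q.2.
  rewrite mem_pmap; split.
    move=> /mapP[[j|//] /flattenP[_ /mapP[q qc ->] jq] [->]]; by exists q.
  move=> [q qc iq]; apply/mapP; exists (inl i) => //.
  by apply/flattenP; exists q.2 => //; exact: map_f.
have : l = [::] \/ exists2 i, i \in l & forall j, j \in l -> j = i \/ lt j i.
  elim: l {lP} => [|i l [->|[m ml mmax]]]; first by left.
    by right; exists i; rewrite ?inE // => j; rewrite inE => /eqP; left.
  right; case: (tot i m) => [im|im|mi].
  - exists m; first by rewrite inE ml orbT.
    by move=> j; rewrite inE => /orP[/eqP ->|/mmax]; [right|].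
  - exists m; first by rewrite inE ml orbT.
    by move=> j; rewrite inE => /orP[/eqP ->|/mmax]; [left|].
  - exists i; first by rewrite inE eqxx.
    move=> j; rewrite inE => /orP[/eqP ->|/mmax [->|jm]]; [by left|by right|].
    by right; exact: tr mi.
move=> [l0|[i il imax]].
  left=> q qc j jq; suff : j \in l by rewrite l0.
  by apply/lP; exists q.
right; exists i; split.
  by move=> q qc j jq; apply: imax; apply/lP; exists q.
by move=> ov; move/lP: il => [q qc iq]; exact: (ov q qc i iq).
Qed.

(** A form of the omega_1-saturation of the reduced power of [P] modulo finite
    sets: a type in aleph_1 variables is realized if it is finitely satisfiable
    in [P]. The recursion involves only finite conjunctions and existential
    quantifiers, and both are compatible with truth from some rank on, so that
    no ultrafilter is needed. *)
Theorem saturation (lt : I -> I -> Prop) (i0 : I) :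
  omega1_like lt ->
  (forall G : seq (C * seq I), (forall q, q \in G -> good q.1 q.2) ->
    exists v : I -> P, forall q, q \in G -> R q.1 (map v q.2)) ->
  exists f : nat -> I -> P, forall c l, good c l ->
    \forall n \near \oo, R c (map (f n) l).
Proof.
move=> [ltwo segs] fin; have [wf tr tot] := ltwo.
have [//|v0 _] := fin [::].
pose below i := [set j | lt j i].
pose extend i (rec : forall j, lt j i -> nat -> P) n j :=
  if pselect (lt j i) is left h then rec j h n else v0 j.
pose spec i (rec : forall j, lt j i -> nat -> P) (g : nat -> P) :=
  realizes (below i `|` [set i]) (fun n => update (extend i rec n) i (g n)).
pose step i (rec : forall j, lt j i -> nat -> P) : nat -> P :=
  if pselect (exists g, spec i rec g) is left h then proj1_sig (cid h)
  else fun=> v0 i.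
pose G := Fix wf (fun=> nat -> P) step.
have GE i : G i = step i (fun j _ => G j).
  apply: Fix_eq => {}i r s rs; congr (step i _).
  by apply: functional_extensionality_dep => j;
     apply: functional_extensionality_dep => h; exact: rs.
pose f n i := G i n.
(* A formula over [A] mentions finitely many indices: it is over an initial
   segment that has a largest element in [A], unless it mentions no index; in
   that case it is satisfiable by assumption. *)
have limitP A : (forall i, A i -> realizes (below i `|` [set i]) f) -> realizes A f.
  move=> fA c cA cgood.
  have [c0|[i [ci nci]]] := max_index c ltwo.
    have [rho rhoP] := cgood.
    have [|v vP] := fin [seq (q.1, map (value id rho) q.2) | q <- c].
      by move=> _ /mapP[q qc ->]; exact: rhoP.
    apply: nearW => n; exists (v \o rho) => q qc.
    have := vP _ (map_f _ qc); rewrite /= -map_comp.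
    congr (R _ _); apply/eq_in_map => -[j|//] /= jq.
    by have := c0 q qc j jq.
  have Ai : A i.
    apply: contrapT => nAi; apply: nci => q qc j /(cA q qc) Aj ji.
    by apply: nAi; rewrite -ji.
  apply: (fA i Ai) => // q qc j jq; have [->|ji] := ci q qc j jq; first by right.
  by left.
have all i : realizes (below i `|` [set i]) f.
  elim: (wf i) => {}i _ IH.
  have fi : realizes (below i) f by exact: limitP.
  have [g gspec] : exists g, spec i (fun j _ => G j) g.
    apply: realize_step; first exact: segs.
    apply: realizes_ext fi => n j ji; rewrite /extend.
    by case: pselect.
  have Gspec : spec i (fun j _ => G j) (G i).
    rewrite GE /step; case: pselect => [h|[]]; last by exists g.
    exact: (proj2_sig (cid h)).
  apply: realizes_ext Gspec => n j ji; rewrite /update /extend.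
  by case: eqP => [->//|nji]; case: pselect => // h; case: ji.
exists f => c l cl.
have [|||N _ fN] := limitP setT _ [:: (c, map inl l)].
- by move=> i _; exact: all.
- by [].
- exists (fun=> i0) => q; rewrite inE => /eqP -> /=; rewrite -map_comp.
  by rewrite (_ : map _ _ = map id l) ?map_id.
exists N => // n /fN [e eh]; have := eh (c, map inl l); rewrite inE eqxx /= -map_comp.
by rewrite (_ : map _ _ = map (f n) l); first exact.
Qed.

End Saturation.

Local Open Scope ring_scope.

(** * Chains in a connected space *)

(** An open box with rational ends. Sides without a coordinate, and coordinates
    without a side, impose no condition. *)
Definition box (R : realType) (b : seq (rat * rat)) (x : seq R) : bool :=
  all (fun p : (rat * rat) * R => ratr p.1.1 < p.2 < ratr p.1.2) (zip b x).

(** The cylinder over a rational box in the coordinates listed in [D]. *)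
Definition inbox (R : realType) (I : Type) (D : seq (I * (rat * rat)))
    (x : I -> R) : bool :=
  all (fun d => ratr d.2.1 < x d.1 < ratr d.2.2) D.

Lemma box_inbox (R : realType) (I : Type) (D : seq (I * (rat * rat)))
    (x : I -> R) : box (map snd D) (map x (map fst D)) = inbox D x.
Proof. by elim: D => //= d D <-. Qed.

Lemma inbox_cat (R : realType) (I : Type) (D D' : seq (I * (rat * rat)))
    (x : I -> R) : inbox (D ++ D') x = inbox D x && inbox D' x.
Proof. exact: all_cat. Qed.

(** The sequences [u i] converge to the image of [K] under the [phi i] with
    steps tending to 0, and accumulate at each of its points; the topology of
    the cube enters through finitely many coordinates at a time. *)
Definition shadowing_walk (R : realType) (K I : Type) (phi : I -> K -> R)
    (u : I -> nat -> R) : Prop :=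
  [/\ forall i t, 0 <= u i t <= 1,
    forall i e, 0 < e -> \forall t \near \oo, `|u i t - u i t.+1| < e,
    forall D, (forall z, ~~ inbox D (phi ^~ z)) ->
      \forall t \near \oo, ~~ inbox D (u ^~ t) &
    forall D z, inbox D (phi ^~ z) ->
      forall T, exists2 t, (T <= t)%N & inbox D (u ^~ t)].

Lemma filter_seq (T : Type) (F : set_system T) {FF : Filter F} (I : eqType)
    (Q : I -> T -> Prop) (r : seq I) :
  (forall i, i \in r -> F (Q i)) -> F [set x | forall i, i \in r -> Q i x].
Proof.
elim: r => [|i r IH] Fr; first by apply: filterS filterT => x _ i.
have Fi : F (Q i) by apply: Fr; exact: mem_head.
have {}IH : F [set x | forall i, i \in r -> Q i x].
  by apply: IH => j jr; apply: Fr; rewrite inE jr orbT.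
apply: filterS2 Fi IH => x Qx rx j.
by rewrite inE => /orP[/eqP ->|/rx].
Qed.

Section Chains.
Variables (R : realType) (K : topologicalType) (k0 : K) (I : eqType).
Variable phi : I -> K -> R.
Hypothesis K_connected : connected [set: K].
Hypothesis phi_cont : forall i, continuous (phi i).
Hypothesis phi_k0 : forall i, phi i k0 = 0.
Hypothesis phi01 : forall i z, 0 <= phi i z <= 1.

Section Close.
Variables (r : seq I) (e : R).
Hypothesis e_gt0 : 0 < e.

Definition close (z z' : K) : bool := all (fun i => `|phi i z - phi i z'| < e) r.

Lemma close_sym z z' : close z z' = close z' z.
Proof. by apply: eq_all => i; rewrite distrC. Qed.

Lemma near_close z : \forall z' \near z, close z z'.
Proof.
have : \forall z' \near z, forall i, i \in r -> `|phi i z - phi i z'| < e.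
  by apply: filter_seq => i _; move/cvgrPdist_lt: (@phi_cont i z); exact.
by apply: filterS => z' zz'; apply/allP.
Qed.

(** The points that can be reached from [a] form a clopen set. *)
Lemma chain_between a b : exists2 zs, path close a zs & last a zs = b.
Proof.
pose Z := [set z | exists2 zs, path close a zs & last a zs = z].
have ZE z z' : close z z' -> Z z -> Z z'.
  move=> zz' [zs czs zsz]; exists (rcons zs z'); last by rewrite last_rcons.
  by rewrite rcons_path czs zsz.
suff: Z = setT by move=> ZT; have : Z b by rewrite ZT.
apply: K_connected; first by exists a; exists [::].
  exists Z; last by rewrite setTI.
  rewrite openE => z Zz; have := near_close z.
  by apply: filterS => z' /ZE; exact.
exists Z; last by rewrite setTI.
rewrite -[Z]setCK; apply: open_closedC; rewrite openE => z nZz.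
have := near_close z.
by apply: filterS => z' zz' Zz'; apply: nZz; apply: ZE Zz'; rewrite close_sym.
Qed.

(** Reading the default value [k0] beyond the end of [zs] closes the loop. *)
Lemma loop_through (ws : seq K) : exists zs : seq K,
  (forall s, close (nth k0 (k0 :: zs) s) (nth k0 zs s)) /\
  (forall w, w \in ws -> exists s, nth k0 zs s = w).
Proof.
have [zs [pzs lzs wzs]] : exists zs, [/\ path close k0 zs, last k0 zs = k0 &
    forall w, w \in ws -> w \in k0 :: zs].
  elim: ws => [|w ws [zs [pzs lzs wzs]]]; first by exists [::].
  have [p pp lp] := chain_between k0 w; have [q pq lq] := chain_between w k0.
  exists (p ++ q ++ zs); split.
  - by rewrite !cat_path pp lp pq lq.
  - by rewrite !last_cat lp lq.
  - move=> x; rewrite inE => /orP[/eqP ->|/wzs].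
      by rewrite -cat_cons mem_cat -lp mem_last.
    by rewrite !inE !mem_cat => /orP[->//|->]; rewrite !orbT.
exists zs; split=> [s|w /wzs].
  have [ss|ss] := ltnP s (size zs); first exact: (pathP k0 pzs).
  rewrite [X in close _ X]nth_default //.
  suff -> : nth k0 (k0 :: zs) s = k0.
    by apply/allP => i _; rewrite subrr normr0.
  move: ss; rewrite leq_eqVlt => /orP[/eqP <-|ss]; last by rewrite nth_default.
  by rewrite -[size zs]/((size (k0 :: zs)).-1) nth_last.
rewrite inE => /orP[/eqP ->|/nthP]; first by exists (size zs); rewrite nth_default.
by move=> /(_ k0) [s _ sw]; exists s.
Qed.

End Close.

(** Meant for the values of one coordinate along a closed chain based at [k0];
    the default value 0, read beyond the end, is the coordinate of [k0]. *)
Definition walk : Type := {x : seq R | forall s, 0 <= nth 0 x s <= 1}.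

(** The three kinds of facts, in the order of the sum: two coordinates are taken
    along chains of the same length; a coordinate has steps shorter than
    [m.+1%:R^-1]; a box in several coordinates is met, or is missed, according
    to the boolean. *)
Definition walk_code : Type := (unit + nat + bool * seq (rat * rat))%type.

Definition walk_rel (c : walk_code) (l : seq walk) : Prop :=
  match c, l with
  | inl (inl _), [:: x; y] => size (sval x) = size (sval y)
  | inl (inr m), [:: x] =>
      forall s, `|nth 0 (0 :: sval x) s - nth 0 (sval x) s| < m.+1%:R^-1
  | inr (h, b), _ => h <-> exists s, box b [seq nth 0 (sval x) s | x <- l]
  | _, _ => True
  end.

Definition walk_good (c : walk_code) (l : seq I) : Prop :=
  if c is inr (h, b) then h <-> exists z, box b [seq phi i z | i <- l] else True.

Lemma nth_map_phi i zs s : nth 0 (map (phi i) zs) s = phi i (nth k0 zs s).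
Proof.
have [ss|ss] := ltnP s (size zs); first by rewrite (nth_map k0).
by rewrite !nth_default ?size_map // phi_k0.
Qed.

Lemma walk_finitely_good (G : seq (walk_code * seq I)) :
  (forall q, q \in G -> walk_good q.1 q.2) ->
  exists v : I -> walk, forall q, q \in G -> walk_rel q.1 (map v q.2).
Proof.
move=> Ggood.
have /choice [w wP] : forall q : walk_code * seq I, exists z,
    if q.1 is inr (true, b) then q \in G -> box b [seq phi i z | i <- q.2] else True.
  move=> [[c|[[] b]] l] /=; [by exists k0| |by exists k0].
  have [qG|nqG] := boolP ((inr (true, b), l) \in G); last by exists k0.
  by have [/(_ isT) [z zb] _] := Ggood _ qG; exists z.
pose m (q : walk_code * seq I) := if q.1 is inl (inr m) then m else 0%N.
pose M := (\max_(q <- G) m q)%N.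
have M0 : (0 : R) < M.+1%:R^-1 by rewrite invr_gt0.
have [zs [czs wzs]] := loop_through (flatten (map snd G)) M0 (map w G).
have v_bounds i s : 0 <= nth 0 (map (phi i) zs) s <= 1.
  by rewrite nth_map_phi.
pose v i : walk := exist _ (map (phi i) zs) (v_bounds i).
exists v => -[[[[]|n]|[h b]] l] qG /=.
- by case: l qG => [|i [|j []]] //= _; rewrite !size_map.
- case: l qG => [|i []] //= qG s.
  have -> : nth 0 (0 :: map (phi i) zs) s = phi i (nth k0 (k0 :: zs) s).
    by case: s => [|s] /=; rewrite ?phi_k0 // nth_map_phi.
  rewrite nth_map_phi; apply: (@lt_le_trans _ _ M.+1%:R^-1).
    move/allP: (czs s); apply; apply/flattenP; exists [:: i]; rewrite ?inE //.
    by apply/mapP; eexists; first exact: qG.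
  rewrite lef_pV2 ?posrE // ler_nat ltnS.
  exact: (leq_bigmax_seq _ qG isT).
have bE s : [seq nth 0 (sval x) s | x <- map v l] =
    [seq phi i (nth k0 zs s) | i <- l].
  by rewrite -map_comp; apply: eq_map => i /=; rewrite nth_map_phi.
have [hz zh] := Ggood _ qG; split=> [hT|[s]].
  rewrite hT in qG; have [s sw] := wzs _ (map_f w qG); exists s.
  by rewrite bE sw; exact: (wP (inr (true, b), l)).
by rewrite bE => sb; apply: zh; eexists; exact: sb.
Qed.

End Chains.

(** * Concatenation of chains *)

Section Positions.
(** The positions [(n, s)] with [s <= N n] are traversed block after block. *)
Variable N : nat -> nat.

Definition next (p : nat * nat) : nat * nat :=
  if (p.2 < N p.1)%N then (p.1, p.2.+1) else (p.1.+1, 0%N).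

Definition pos (t : nat) : nat * nat := iter t next (0%N, 0%N).

Lemma pos_le t : ((pos t).2 <= N (pos t).1)%N.
Proof.
elim: t => [|t IH] //; rewrite /pos iterS -/(pos t) /next.
by case: ifP.
Qed.

Lemma pos_homo t t' : (t <= t')%N -> ((pos t).1 <= (pos t').1)%N.
Proof.
move=> /subnK <-; elim: (t' - t)%N => // d IH; apply: leq_trans IH _.
by rewrite addSn /pos iterS -/(pos _) /next; case: ifP => //= _; exact: leqW.
Qed.

Lemma pos_onto n s : (s <= N n)%N -> exists t, pos t = (n, s).
Proof.
elim: n s => [|n IHn]; elim=> [|s IHs] sN.
- by exists 0%N.
- have [t ts] := IHs (ltnW sN); exists t.+1.
  by rewrite /pos iterS -/(pos t) ts /next /= sN.
- have [t ts] := IHn (N n) (leqnn _); exists t.+1.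
  by rewrite /pos iterS -/(pos t) ts /next /= ltnn.
- have [t ts] := IHs (ltnW sN); exists t.+1.
  by rewrite /pos iterS -/(pos t) ts /next /= sN.
Qed.

Lemma pos_cvg : (pos t).1 @[t --> \oo] --> \oo.
Proof.
move=> A [n _ nA]; have [T Tn] := pos_onto (leq0n (N n)).
by exists T => // t /pos_homo; rewrite Tn => /nA.
Qed.

End Positions.

(** The chains provided by saturation are traversed one after another. The
    length of the coordinate [i0] governs the traversal; each other coordinate
    has the same length in all but finitely many blocks. *)
Theorem approximating_walk (R : realType) (K : topologicalType) (k0 : K)
    (I : eqType) (phi : I -> K -> R) (lt : I -> I -> Prop) (i0 : I) :
  omega1_like lt -> connected [set: K] -> (forall i, continuous (phi i)) ->
  (forall i, phi i k0 = 0) -> (forall i z, 0 <= phi i z <= 1) ->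
  exists u : I -> nat -> R, shadowing_walk phi u.
Proof.
move=> ltI Kc phic phi0 phi01.
have [f fP] := saturation i0 ltI (walk_finitely_good Kc phic phi0 phi01).
pose N n := size (sval (f n i0)).
pose u i t := nth 0 (sval (f (pos N t).1 i)) (pos N t).2.
have late (Q : nat -> Prop) : (\forall n \near \oo, Q n) ->
    \forall t \near \oo, Q (pos N t).1.
  by move=> Qn; exact: (@pos_cvg N _ Qn).
have sizes i : \forall n \near \oo, size (sval (f n i)) = N n.
  by have := fP (inl (inl tt)) [:: i; i0] Logic.I.
have steps i e : 0 < e -> \forall n \near \oo, forall s,
    `|nth 0 (0 :: sval (f n i)) s - nth 0 (sval (f n i)) s| < e.
  move=> e0; have [m me] : exists m, m.+1%:R^-1 < e.
    have [m _ mP] := near_infty_natSinv_lt (PosNum e0).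
    by exists m; apply: (mP m) => /=.
  apply: filterS (fP (inl (inr m)) [:: i] Logic.I) => n /= fn s.
  exact: lt_trans me.
exists u; split.
- by move=> i t; rewrite /u; case: (f _ _).
- move=> i e e0.
  have [T1 _ T1P] := late _ (sizes i); have [T2 _ T2P] := late _ (steps i e e0).
  exists (maxn T1 T2) => // t; rewrite /= geq_max => /andP[T1t T2t].
  rewrite /u /pos iterS -/(pos N t) /next.
  have := T2P _ (leqW T2t); rewrite /pos iterS -/(pos N t) /next.
  have := T1P _ T1t; have := T2P _ T2t; have := pos_le N t.
  case: (pos N t) => n s /= sN Pn sz; case: ifP => [ss _|/= ss /(_ 0%N)/=].
    exact: (Pn s.+1).
  by rewrite [nth 0 (sval (f n i)) s]nth_default // sz leqNgt ss.
- move=> D nD.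
  have goodD : walk_good phi (inr (false, map snd D)) (map fst D).
    by split=> // -[z]; rewrite box_inbox (negbTE (nD z)).
  apply: filterS (late _ (fP _ _ goodD)) => t [_ h]; apply/negP.
  rewrite -box_inbox => tD; apply: notF; apply: h; exists (pos N t).2.
  by rewrite -!map_comp in tD *.
- move=> D z zD T; rewrite -box_inbox in zD.
  have [|M _ MP] := fP (inr (true, map snd D)) (map fst D).
    by split=> // _; exists z.
  have [M' _ M'P] := filter_seq (r := map fst D) (fun i _ => sizes i).
  pose n := maxn (maxn M M') (pos N T).1.+1.
  have [/(_ isT) [s sb] _] := MP n (leq_trans (leq_maxl _ _) (leq_maxl _ _)).
  have szn := M'P n (leq_trans (leq_maxr _ _) (leq_maxl _ _)).
  (* Beyond the common length all the coordinates are 0, as they are at the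
     position [N n], which is visited. *)
  have [t tE] := pos_onto (geq_minr s (N n)).
  exists t.
    rewrite leqNgt; apply/negP => /ltnW /(pos_homo N); rewrite tE /= => nT.
    by have := leq_trans (leq_maxr _ _ : (_ < n)%N) nT; rewrite ltnn.
  rewrite -box_inbox; move: sb szn; move: (map fst D) => r sb szn.
  move: sb; rewrite -map_comp; congr box; apply/eq_in_map => i /szn ni /=.
  rewrite /u tE /=; have [//|Ns] := leqP s (N n).
  by rewrite !nth_default ?ni // ltnW.
Qed.

(** * Piecewise linear interpolation *)

Section Interpolation.
Variables (R : realType).

Definition clamp (x : R) : R := Num.max 0 (Num.min 1 x).

Lemma clamp_itv x : 0 <= clamp x <= 1.
Proof. by rewrite /clamp le_max lexx /= ge_max ler01 ge_min lexx. Qed.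

Lemma clamp_id x : 0 <= x <= 1 -> clamp x = x.
Proof. by move=> /andP[x0 x1]; rewrite /clamp min_r // max_r. Qed.

Lemma clamp_le0 x : x <= 0 -> clamp x = 0.
Proof. by move=> x0; rewrite /clamp max_l // ge_min x0 orbT. Qed.

Lemma clamp_ge1 x : 1 <= x -> clamp x = 1.
Proof. by move=> x1; rewrite /clamp min_l // max_r. Qed.

Lemma clamp_continuous : continuous clamp.
Proof.
apply: max_fun_continuous; first exact: cst_continuous.
by apply: min_fun_continuous; [exact: cst_continuous|move=> x; exact: cvg_id].
Qed.

Variable u : nat -> R.

(** Interpolation up to the node [M], as a sum of ramps; for a given [t] the
    terms with [t <= k] vanish, so that locally the interpolation coincides with
    a finite sum of continuous functions. *)
Definition ramp_sum (M : nat) (t : R) : R :=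
  u 0 + \sum_(k < M) clamp (t - k%:R) * (u k.+1 - u k).

Lemma ramp_sumS M t :
  ramp_sum M.+1 t = ramp_sum M t + clamp (t - M%:R) * (u M.+1 - u M).
Proof. by rewrite /ramp_sum big_ord_recr /= addrA. Qed.

Lemma ramp_sum_continuous M : continuous (ramp_sum M).
Proof.
elim: M => [|M IH].
  rewrite (_ : ramp_sum 0 = fun=> u 0); first exact: cst_continuous.
  by apply/funext => s; rewrite /ramp_sum big_ord0 addr0.
have shift_cont : continuous (fun t : R => t - M%:R).
  by move=> s; apply: cvgB; [exact: cvg_id|exact: cvg_cst].
have clamp_cont : continuous (clamp \o (fun t : R => t - M%:R)).
  move=> s; apply: continuous_comp; first exact: shift_cont.
  exact: clamp_continuous.
rewrite (_ : ramp_sum M.+1 =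
    fun t => ramp_sum M t + clamp (t - M%:R) * (u M.+1 - u M)).
  by move=> s; apply: cvgD; [exact: IH|apply: cvgMr_tmp; exact: clamp_cont].
by apply/funext => s; rewrite ramp_sumS.
Qed.

Lemma ramp_sum_ge M t : M%:R <= t -> ramp_sum M t = u M.
Proof.
elim: M => [|M IH] Mt; first by rewrite /ramp_sum big_ord0 addr0.
rewrite ramp_sumS IH; last by apply: le_trans Mt; rewrite ler_nat.
rewrite clamp_ge1 ?mul1r; first lra.
by rewrite lerBrDr -natr1 addrC in Mt *.
Qed.

Lemma ramp_sum_stable M M' t : t <= M%:R -> (M <= M')%N ->
  ramp_sum M' t = ramp_sum M t.
Proof.
move=> tM /subnK <-; elim: (M' - M)%N => // d IH.
rewrite addSn ramp_sumS IH clamp_le0 ?mul0r ?addr0 // subr_le0.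
by apply: le_trans tM _; rewrite ler_nat leq_addl.
Qed.

Definition interpolate (t : R) : R := ramp_sum (Num.truncn t).+1 t.

Lemma interpolateE t : 0 <= t -> let m := Num.truncn t in
  interpolate t = u m + (t - m%:R) * (u m.+1 - u m).
Proof.
move=> /truncn_itv /andP[mt tm] /=; rewrite /interpolate ramp_sumS.
rewrite ramp_sum_ge // clamp_id //.
by rewrite subr_ge0 mt lerBlDr addrC natr1 ltW.
Qed.

Lemma interpolate_nat n : interpolate n%:R = u n.
Proof. by rewrite interpolateE // natrK subrr mul0r addr0. Qed.

Lemma interpolate_close t : 0 <= t -> let m := Num.truncn t in
  `|interpolate t - u m| <= `|u m - u m.+1|.
Proof.
move=> t0 /=; rewrite interpolateE // addrC addKr normrM distrC.
rewrite [leRHS]distrC -[leRHS]mul1r ler_wpM2r //.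
have /andP[mt tm] := truncn_itv t0; rewrite distrC ger0_norm ?subr_ge0 //.
by rewrite lerBlDr addrC natr1 ltW.
Qed.

Lemma interpolate_itv t : (forall n, 0 <= u n <= 1) -> 0 <= t ->
  0 <= interpolate t <= 1.
Proof.
move=> u01 t0; have /andP[mt tm] := truncn_itv t0; rewrite interpolateE //.
rewrite -natr1 in tm.
have /andP[a0 a1] := u01 (Num.truncn t); have /andP[b0 b1] := u01 (Num.truncn t).+1.
move: (u _) (u _) a0 a1 b0 b1 => b a a0 a1 b0 b1.
have s0 : 0 <= t - (Num.truncn t)%:R by lra.
have s1 : t - (Num.truncn t)%:R <= 1 by lra.
move: (t - _) s0 s1 => s s0 s1.
have -> : a + s * (b - a) = (1 - s) * a + s * b by ring.
apply/andP; split; first by rewrite addr_ge0 ?mulr_ge0 ?subr_ge0.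
rewrite -subr_ge0.
have -> : 1 - ((1 - s) * a + s * b) = (1 - s) * (1 - a) + s * (1 - b) by ring.
by rewrite addr_ge0 ?mulr_ge0 ?subr_ge0.
Qed.

Lemma interpolate_continuous : continuous interpolate.
Proof.
move=> t; pose M := (Num.truncn t).+1.
have tM : t < M%:R by exact: truncnS_gt.
have iE s : s < M%:R -> interpolate s = ramp_sum M s.
  move=> sM; rewrite /interpolate (@ramp_sum_stable (Num.truncn s).+1 M) //.
    exact/ltW/truncnS_gt.
  by rewrite ltnS truncn_le_nat.
rewrite /continuous_at (iE t tM).
apply: cvg_trans (@ramp_sum_continuous M t); apply: near_eq_cvg.
near=> s; rewrite iE //; near: s; exact: lt_nbhsl.
Unshelve. all: by end_near. Qed.

End Interpolation.

(** * The remainder of the half line *)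

Lemma continuous_subtype (X Y : topologicalType) (A : set Y) (f : X -> A) :
  continuous (set_val \o f) -> continuous f.
Proof. exact: continuous_comp_initial. Qed.

Lemma set_val_continuous (Y : topologicalType) (A : set Y) :
  continuous (set_val : A -> Y).
Proof. exact: initial_continuous. Qed.

Lemma continuous_to_prod (X : topologicalType) (I : Type)
    (T : I -> topologicalType) (f : X -> prod_topology T) :
  (forall i, continuous (fun x => f x i)) -> continuous f.
Proof.
move=> fc x; apply/cvg_sup => i.
by apply: (@continuous_comp_initial _ X (T i) (fun g : forall i, T i => g i) f); exact: fc.
Qed.

Section UnitHalf.
Variable R : realType.

Lemma clamp_mem (x : R) : clamp x \in `[0 : R, 1]%classic.
Proof. by rewrite inE /= in_itv /= clamp_itv. Qed.

Definition to_unit (x : R) : unit_interval R := exist _ (clamp x) (clamp_mem x).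

Lemma to_unit_continuous : continuous to_unit.
Proof. apply: continuous_subtype; exact: clamp_continuous. Qed.

Lemma unit_interval_compact : compact [set: unit_interval R].
Proof.
have -> : [set: unit_interval R] = to_unit @` `[0, 1].
  apply/seteqP; split=> // x _; have := set_valP x; rewrite /= => x01.
  by exists (set_val x) => //; apply: val_inj => /=; rewrite clamp_id.
apply: continuous_compact; last exact: segment_compact.
apply: continuous_subspaceT; exact: to_unit_continuous.
Qed.

Lemma unit_interval_hausdorff : hausdorff_space (unit_interval R).
Proof.
move=> p q pq; apply: val_inj; apply: (@norm_hausdorff R R) => A B Ap Bq.
have [x [xA xB]] := pq _ _ (set_val_continuous Ap) (set_val_continuous Bq).
by exists (set_val x).
Qed.

Lemma max0_mem (x : R) : Num.max 0 x \in `[0 : R, +oo[%classic.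
Proof. by rewrite inE /= in_itv /= andbT le_max lexx. Qed.

Definition to_half (x : R) : half_line R := exist _ (Num.max 0 x) (max0_mem x).

Lemma to_half_continuous : continuous to_half.
Proof.
apply: continuous_subtype; apply: max_fun_continuous; first exact: cst_continuous.
by move=> x; exact: cvg_id.
Qed.

Definition time (t : half_line R) : R := set_val t.

Lemma time_continuous : continuous time.
Proof. exact: set_val_continuous. Qed.

Lemma time_ge0 t : 0 <= time t.
Proof. by have := set_valP t; rewrite /= in_itv /= andbT. Qed.

Lemma to_halfK x : 0 <= x -> time (to_half x) = x.
Proof. by move=> x0; rewrite /time set_valE /= max_r. Qed.

Lemma half_line_initial_compact (T : R) : compact [set t : half_line R | time t <= T].
Proof.
have -> : [set t : half_line R | time t <= T] =
    to_half @` `[0, T] `&` [set t | time t <= T].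
  apply/seteqP; split=> [t tT|t []//]; split=> //.
  exists (time t); first by rewrite /= in_itv /= time_ge0.
  by apply: val_inj; exact: to_halfK (time_ge0 t).
apply: compact_closedI.
  apply: continuous_compact; last exact: segment_compact.
  apply: continuous_subspaceT; exact: to_half_continuous.
rewrite (_ : [set _ | _] = time @^-1` [set x | x <= T]) //.
by apply: preimage_closed; [move=> ? _; exact: time_continuous|exact: closed_le].
Qed.

End UnitHalf.

Section Remainder.
Variable R : realType.

Let cube := cech_cube R (half_line R).

Lemma cech_eval_continuous : continuous (@cech_eval R (half_line R)).
Proof. by apply: continuous_to_prod => h; exact: cts_fun. Qed.

Lemma cube_compact : compact [set: cube].
Proof.
have := @tychonoff _
  (fun _ : continuousType (half_line R) (unit_interval R) => unit_interval R)
  (fun=> setT) (fun=> @unit_interval_compact R).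
by rewrite (_ : [set _ | _] = setT) //; apply/seteqP; split.
Qed.

Lemma cube_hausdorff : hausdorff_space cube.
Proof. by apply: hausdorff_product => h; exact: unit_interval_hausdorff. Qed.

Definition coord (h : continuousType (half_line R) (unit_interval R))
  (p : cube) : R := set_val (p h).

Lemma coord_continuous h : continuous (coord h).
Proof.
move=> p; apply: (@continuous_comp cube _ _ (proj h) set_val).
  exact: proj_continuous.
exact: set_val_continuous.
Qed.

(** The images of the points at time at most [T] form a compact, hence closed,
    set that avoids the remainder. *)
Lemma remainder_late (p : cube) (V : set cube) (T : R) :
  @cech_remainder R (half_line R) p -> nbhs p V ->
  exists t : half_line R, T <= time t /\ V (@cech_eval R _ t).
Proof.
move=> [clp np] Vp.
pose E := @cech_eval R (half_line R) @` [set t | time t <= T].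
have Ecl : closed E.
  apply: compact_closed; first exact: cube_hausdorff.
  apply: continuous_compact; last exact: half_line_initial_compact.
  apply: continuous_subspaceT; exact: cech_eval_continuous.
have nE : ~ E p by move=> [t _ tp]; apply: np; exists t.
have /clp [_ [[t _ <-] [nEt Vt]]] : nbhs p (~` E `&` V).
  apply: filterI => //; apply: open_nbhs_nbhs; split=> //.
  exact: closed_openC.
exists t; split=> //; rewrite leNgt; apply/negP => tT; apply: nEt.
by exists t => //=; exact: ltW.
Qed.

(** The function [t |-> clamp (t - t0)] separates the image of [t0] from those
    of all times beyond [t0 + 1]. *)
Lemma cluster_late_remainder (F : set_system (half_line R)) (p : cube) :
  Filter F -> (forall T, F [set t | T <= time t]) ->
  cluster (@cech_eval R (half_line R) @ F) p -> @cech_remainder R (half_line R) p.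
Proof.
move=> FF late clp; split.
  move=> V Vp; apply: clp => //.
  have : F (@cech_eval R _ @^-1` range (@cech_eval R (half_line R))).
    by apply: filterS (late 0) => t _; exists t.
  by [].
move=> [t0 _ t0p].
have shift_cont : continuous (fun x : R => x - time t0).
  by move=> x; apply: cvgB; [exact: cvg_id|exact: cvg_cst].
have hc : continuous (@to_unit R \o ((fun x : R => x - time t0) \o @time R)).
  move=> t; apply: continuous_comp; last exact: to_unit_continuous.
  by apply: continuous_comp; [exact: time_continuous|exact: shift_cont].
pose h : continuousType (half_line R) (unit_interval R) := mkcts hc.
have hE t : coord h (@cech_eval R _ t) = clamp (time t - time t0).
  by rewrite /coord set_valE.
have ph : coord h p = 0 by rewrite -t0p hE subrr clamp_le0.
have Fh : F (@cech_eval R _ @^-1` [set q | coord h q = 1]).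
  apply: filterS (late (time t0 + 1)) => t /= tt0.
  by rewrite hE clamp_ge1 // lerBrDl.
have ph1 : nbhs p [set q | coord h q < 1].
  by apply: (@coord_continuous h p [set x | x < 1]); rewrite ph; exact: lt_nbhsl.
have [q [/= qh1]] := clp _ _ Fh ph1.
by rewrite qh1 ltxx.
Qed.

End Remainder.

(** * The map induced by a walk *)

Lemma cluster_cvg_eq (X Y : topologicalType) (F : set_system X) (h : X -> Y)
    (x : X) (y : Y) : hausdorff_space Y ->
  cluster F x -> {for x, continuous h} -> h @ F --> y -> h x = y.
Proof.
move=> hY Fx hx hF; apply: hY => A B Ahx By.
have [x' [Bx' Ax']] := Fx _ _ (hF _ By) (hx _ Ahx).
by exists (h x').
Qed.

Lemma cvg_rat_squeeze (R : realType) (X : Type) (F : set_system X) (h : X -> R)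
    (a : R) : Filter F ->
  (forall q q' : rat, ratr q < a < ratr q' -> F [set x | ratr q < h x < ratr q']) ->
  h @ F --> a.
Proof.
move=> FF hF; apply/cvgrPdist_lt => e e0.
have [q qa] : exists q : rat, ratr q \in `]a - e, a[%R by apply: rat_in_itvoo; lra.
have [q' q'a] : exists q : rat, ratr q \in `]a, a + e[%R by apply: rat_in_itvoo; lra.
move: qa q'a; rewrite !in_itv /= => /andP[q1 q2] /andP[q3 q4].
apply: filterS (hF q q' _) => [x /= /andP[x1 x2]|]; last by rewrite q2 q3.
by rewrite ltr_distlC; apply/andP; split; lra.
Qed.

Section Map.
Variables (R : realType) (K : topologicalType) (I : eqType).
Variables (phi : I -> K -> R) (u : I -> nat -> R).
Hypothesis K_compact : compact [set: K].
Hypothesis K_hausdorff : hausdorff_space K.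
Hypothesis phi_cont : forall i, continuous (phi i).
Hypothesis phi_sep : forall z z', (forall i, phi i z = phi i z') -> z = z'.
Hypothesis u_walk : shadowing_walk phi u.

Lemma coordinate_continuous i :
  continuous (@to_unit R \o (interpolate (u i) \o @time R)).
Proof.
move=> t; apply: continuous_comp; last exact: to_unit_continuous.
by apply: continuous_comp; [exact: time_continuous|exact: interpolate_continuous].
Qed.

Definition coordinate i : continuousType (half_line R) (unit_interval R) :=
  mkcts (coordinate_continuous (i := i)).

Lemma coordinateE i t :
  coord (coordinate i) (@cech_eval R _ t) = interpolate (u i) (time t).
Proof.
have [u01 _ _ _] := u_walk.
by rewrite /coord set_valE /= clamp_id // interpolate_itv // time_ge0.
Qed.

Lemma inbox_shrink (D : seq (I * (rat * rat))) (x : I -> R) :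
  inbox D x -> exists2 e : R, 0 < e &
  forall d, d \in D -> ratr d.2.1 + e < x d.1 < ratr d.2.2 - e.
Proof.
elim: D => [|d D IH] /=; first by exists 1.
move=> /andP[/andP[d1 d2] /IH [e e0 De]].
pose e' := Num.min e (Num.min ((x d.1 - ratr d.2.1) / 2) ((ratr d.2.2 - x d.1) / 2)).
have e'e : e' <= e by rewrite ge_min lexx.
have e'1 : e' <= (x d.1 - ratr d.2.1) / 2 by rewrite !ge_min lexx orbT.
have e'2 : e' <= (ratr d.2.2 - x d.1) / 2 by rewrite !ge_min lexx !orbT.
exists e'; first by rewrite !lt_min e0 /=; apply/andP; split; lra.
move=> d'; rewrite inE => /orP[/eqP ->|/De /andP[? ?]]; apply/andP; split; lra.
Qed.

Lemma near_inbox (X : topologicalType) (c : I -> X -> R) (p : X)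
    (D : seq (I * (rat * rat))) (e : R) :
  (forall i, continuous (c i)) ->
  (forall d, d \in D -> ratr d.2.1 + e < c d.1 p < ratr d.2.2 - e) ->
  \forall q \near p, forall d, d \in D ->
    ratr d.2.1 + e < c d.1 q < ratr d.2.2 - e.
Proof.
move=> cc De; apply: filter_seq => d /De /andP[d1 d2].
near=> q; apply/andP; split; near: q.
  by apply: (@cc d.1 p [set x | _ < x]); exact: lt_nbhsr.
by apply: (@cc d.1 p [set x | x < _]); exact: lt_nbhsl.
Unshelve. all: by end_near. Qed.

(** Otherwise [u] would eventually stay out of the box, and the interpolated
    curve out of a slightly smaller box around the coordinates of [p]. *)
Lemma remainder_inbox (p : cech_cube R (half_line R)) D :
  cech_remainder p -> inbox D (fun i => coord (coordinate i) p) ->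
  exists z, inbox D (fun i => phi i z).
Proof.
move=> pr pD; apply: contrapT => nz.
have [e e0 De] := inbox_shrink pD.
have [_ u_step u_miss _] := u_walk.
have [N _ NP] : \forall t \near \oo, ~~ inbox D (u ^~ t).
  by apply: u_miss => z; apply/negP => zD; apply: nz; exists z.
have [M _ MP] := filter_seq (r := map fst D) (fun i _ => u_step i e e0).
have [t [Tt tD]] := remainder_late (maxn N M)%:R pr
    (near_inbox (fun i => @coord_continuous _ (coordinate i)) De).
have t0 := time_ge0 t.
have := Tt; rewrite -truncn_ge_nat // geq_max => /andP[/NP + /MP stp].
move=> /allPn[d dD /negP]; apply.
have := interpolate_close (u d.1) t0; have := stp _ (map_f fst dD).
have := tD d dD; rewrite coordinateE => /andP[a1 a2] s1 s2.
have := le_lt_trans s2 s1; rewrite ltr_distl => /andP[b1 b2].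
by apply/andP; split; lra.
Qed.

(** By [remainder_inbox], the points of [K] whose [phi]-coordinates are close to
    the coordinates of [p] generate a proper filter; [z] is a cluster point. *)
Lemma remainder_point (p : cech_cube R (half_line R)) :
  cech_remainder p -> exists z, forall i, phi i z = coord (coordinate i) p.
Proof.
move=> pr; pose c i := coord (coordinate i) p.
pose F := filter_from [set D | inbox D c] (fun D => [set z | inbox D (fun i => phi i z)]).
have FF : ProperFilter F.
  apply: filter_from_proper; last by move=> D /(remainder_inbox pr).
  apply: filter_from_filter; first by exists [::].
  move=> D D' Dc D'c; exists (D ++ D'); first by rewrite /= inbox_cat Dc.
  by move=> z /=; rewrite inbox_cat => /andP.
have [z [_ Fz]] := K_compact FF filterT.
exists z => i; apply: (cluster_cvg_eq (@norm_hausdorff R R) Fz (@phi_cont i z)).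
apply: cvg_rat_squeeze => q q' qq'.
exists [:: (i, (q, q'))]; first by rewrite /= andbT.
by move=> y /=; rewrite andbT.
Qed.

(** [p] is a cluster point of the late times at which the curve is close to the
    [phi]-coordinates of [z]. *)
Lemma point_remainder (z : K) : exists p : cech_cube R (half_line R),
  cech_remainder p /\ forall i, phi i z = coord (coordinate i) p.
Proof.
have [_ _ _ u_hit] := u_walk; pose x i := phi i z.
pose F := filter_from [set Dn : _ * nat | inbox Dn.1 x]
  (fun Dn => [set t : half_line R | Dn.2%:R <= time t /\
                inbox Dn.1 (fun i => interpolate (u i) (time t))]).
have FF : ProperFilter F.
  apply: filter_from_proper.
    apply: filter_from_filter; first by exists ([::], 0%N).
    move=> [D n] [D' n'] /= Dx D'x; exists (D ++ D', maxn n n').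
      by rewrite /= inbox_cat Dx.
    move=> t /=; rewrite inbox_cat => -[nt /andP[tD tD']].
    by split; split=> //; apply: le_trans nt; rewrite ler_nat ?leq_maxl ?leq_maxr.
  move=> [D n] /= /u_hit /(_ n) [m nm mD]; exists (to_half m%:R) => /=.
  rewrite to_halfK ?ler0n // ler_nat; split=> //.
  by under [X in inbox D X]eq_fun do rewrite interpolate_nat.
have [p [_ Fp]] := @cube_compact R _ (fmap_proper_filter (@cech_eval R _) FF) filterT.
exists p; split.
  apply: cluster_late_remainder Fp => T.
  exists ([::], (Num.truncn T).+1) => // t [/= Tt _].
  exact: le_trans (ltW (truncnS_gt T)) Tt.
move=> i; apply/esym.
apply: (cluster_cvg_eq (@norm_hausdorff R R) Fp (@coord_continuous _ (coordinate i) p)).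
apply: cvg_rat_squeeze => q q' qq'.
exists ([:: (i, (q, q'))], 0%N); first by rewrite /= andbT.
by move=> t /= [_]; rewrite andbT coordinateE.
Qed.

(** [g p] is the point of [remainder_point]. The [phi i] separate the points of
    [K] and their composites with [g] are continuous, so that [g p] is the only
    cluster point of [g] at [p]; as [K] is compact, [g] is continuous at [p]. *)
Theorem walk_limit_map :
  exists f : half_line_remainder R -> K, continuous f /\ range f = [set: K].
Proof.
have /choice [g gP] : forall p : half_line_remainder R, exists z,
    forall i, phi i z = coord (coordinate i) (set_val p).
  by move=> p; apply: remainder_point; exact: set_valP.
exists g; split; last first.
  apply/seteqP; split=> // z _; have [p [pr pz]] := point_remainder z.
  exists (exist _ p (mem_set pr)) => //; apply: phi_sep => i.
  by rewrite gP pz set_valE.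
move=> p; have cl z : cluster (g @ p) z -> z = g p.
  move=> gz; apply: phi_sep => i.
  apply: (cluster_cvg_eq (@norm_hausdorff R R) gz (@phi_cont i z)).
  rewrite gP; rewrite (_ : phi i @ _ = (coord (coordinate i) \o set_val) @ p).
    apply: continuous_comp; first exact: set_val_continuous.
    exact: coord_continuous.
  apply/funext => A; rewrite /fmap /=; congr (nbhs p _).
  by apply/funext => q /=; rewrite gP.
have gpF : ProperFilter (g @ p) := fmap_proper_filter g (nbhs_pfilter p).
have gpT : (g @ p) [set: K] by exact: filterT.
apply: (compact_cluster_set1 K_hausdorff K_compact _ _ gpT) => //.
  exact: filterT.
apply/seteqP; split=> [z /cl -> //|_ ->].
have [z [_ gz]] := K_compact gpF gpT.
by rewrite -(cl z gz).
Qed.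

End Map.

(** * Separating functions and the theorem *)

Lemma urysohn_closure (R : realType) (K : topologicalType) (a b : set K) :
  compact [set: K] -> hausdorff_space K -> open b -> closure a `<=` b ->
  exists f : K -> R, [/\ continuous f, forall z, 0 <= f z <= 1,
    forall z, ~ b z -> f z = 0 & forall z, a z -> f z = 1].
Proof.
move=> cK hK bo ab.
have /(@uniform_separatorP _ R) [f [fc f01 f0 f1]] :
    uniform_separator (~` b) (closure a).
  apply: normal_uniform_separator; first exact: compact_normal.
  - exact: open_closedC.
  - exact: closed_closure.
  - by apply/seteqP; split=> // z [nbz /ab].
exists f; split=> // z.
- by have := f01 _ (ex_intro2 _ _ z Logic.I erefl); rewrite /= in_itv.
- by move=> nbz; exact: f0 (ex_intro2 _ _ z nbz erefl).
- by move=> /subset_closure az; exact: f1 (ex_intro2 _ _ z az erefl).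
Qed.

(** The pair [(a, b)] of basic open sets is assigned a function that is 1 on [a]
    and 0 off [b] if [closure a `<=` b] and [k0] is not in [b], and 0 otherwise.
    Of two points one is different from [k0], and the requirement
    [phi i k0 = 0] does not hinder separating that one from the other. *)
Lemma separating_family (R : realType) (K : topologicalType) (B : set (set K))
    (k0 : K) : compact [set: K] -> hausdorff_space K -> basis B ->
  exists phi : B * B -> K -> R, [/\ forall i, continuous (phi i),
    forall i z, 0 <= phi i z <= 1, forall i, phi i k0 = 0 &
    forall z z', (forall i, phi i z = phi i z') -> z = z'].
Proof.
move=> cK hK [Bo Bb].
have /choice [phi phiP] : forall i : B * B, exists f : K -> R,
    [/\ continuous f, forall z, 0 <= f z <= 1, f k0 = 0 &
     closure (set_val i.1) `<=` set_val i.2 -> ~ (set_val i.2) k0 ->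
     (forall z, ~ (set_val i.2) z -> f z = 0) /\ (forall z, (set_val i.1) z -> f z = 1)].
  move=> [a b] /=; have [[ab bk]|nab] := pselect
      (closure (set_val a) `<=` set_val b /\ ~ (set_val b) k0).
    have [|f [fc f01 f0 f1]] := urysohn_closure R cK hK _ ab.
      exact: Bo (set_valP b).
    by exists f; split=> //; exact: f0.
  exists (fun=> 0); split=> [|z|//|ab bk]; first exact: cst_continuous.
    by rewrite lexx ler01.
  by case: nab.
have sep y x : y <> k0 -> y <> x -> exists i, phi i y <> phi i x.
  move=> yk yx.
  have closed1 : forall z : K, closed [set z].
    exact/accessible_closed_set1/hausdorff_accessible.
  have Uy : nbhs y (~` ([set k0] `|` [set x])).
    apply: open_nbhs_nbhs; split; last by move=> -[].
    by apply: closed_openC; exact: closedU.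
  have [b [b_B b_y] bU] := Bb y _ Uy.
  have b_nbhs : nbhs y b by apply: open_nbhs_nbhs; split=> //; exact: Bo.
  have [V Vy Vb] := compact_regular hK cK (filterT : nbhs y setT) b_nbhs.
  have [a [a_B a_y] aV] := Bb y _ Vy.
  exists (exist _ a (mem_set a_B), exist _ b (mem_set b_B)).
  have [_ _ _] := phiP (exist _ a (mem_set a_B), exist _ b (mem_set b_B)).
  rewrite !set_valE /= => /(_ _ _)[||f0 f1].
  - exact: subset_trans (closureS aV) Vb.
  - by move=> /bU; apply; left.
  rewrite f1 // f0; last by move=> /bU; apply; right.
  by apply/eqP; rewrite oner_eq0.
exists phi; split=> [i|i|i|z z' zz'].
- by have [] := phiP i.
- by have [] := phiP i.
- by have [] := phiP i.
apply: contrapT => nzz'; have [zk|zk] := pselect (z = k0).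
  have [||i] := sep z' z; [by move=> z'k; apply: nzz'; rewrite zk|exact/nesym|].
  by rewrite zz'.
by have [//||i] := sep z z'; rewrite ?zz'.
Qed.

Theorem theorem1 (R : realType) (K : topologicalType)
    (hK : continuum K) (wK : weight_aleph1 K) :
  exists f : half_line_remainder R -> K, continuous f /\ range f = [set: K].
Proof.
have [[k0 _] Kc Kconn Kh] := hK; have [B [Bb _ [_ Bmin]]] := wK.
have [phi [phic phi01 phi0 phisep]] := separating_family R k0 Kc Kh Bb.
have [lt0 lt0P] : exists lt : B -> B -> Prop, omega1_like lt.
  apply: omega1_like_minimal => U C nC.
  by rewrite (card_le_eql (card_setT B)); exact: Bmin.
have [lt ltP] := omega1_like_pairs lt0P.
have [b0 _] : exists b : B, True.
  have [_ /(_ k0)] := Bb; move=> /(_ setT filterT) [b [Bb0 _] _].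
  by exists (exist _ b (mem_set Bb0)).
have [u u_walk] :=
  @approximating_walk R K k0 {classic B * B} phi lt (b0, b0) ltP Kconn phic phi0 phi01.
exact: walk_limit_map Kc Kh phic phisep u_walk.
Qed.
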